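(* For $r\ge 5$, the generalised dodecahedron $D_r$ satisfies $\chi_i(D_r)=4$ if and only if $r\not\equiv 0\pmod 3$.
   Context: For $r>2$, the generalised dodecahedron $D_r$ is the graph with vertex set $\{u_0,\dots,u_{r-1},v_0,\dots,v_{r-1},u'_0,\dots,u'_{r-1},v'_0,\dots,v'_{r-1}\}$ and edge set $\{u_iu_{i+1},\ v_iv_{i+1},\ u_iu'_i,\ v_iv'_i,\ v'_iu'_i,\ u'_iv'_{i+1}: 0\le i\le r-1\}$, indices taken modulo $r$. An injective $k$-colouring of a graph $G$ is a map $c:V(G)\to\{1,\dots,k\}$ such that any two distinct vertices with a common neighbour get different colours; the injective chromatic number $\chi_i(G)$ is the least such $k$. *)

(* Defs.v *)
From mathcomp Require Import all_boot.

Set Implicit Arguments.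
Unset Strict Implicit.
Unset Printing Implicit Defensive.

(* A graph on the finite type [T] is given by its adjacency relation. *)

Section InjectiveColouring.
Variables (T : finType) (adj : rel T).

Definition is_injective_colouring (k : nat) (c : {ffun T -> 'I_k}) : bool :=
  [forall x, forall y,
    (x != y) && [exists z, adj z x && adj z y] ==> (c x != c y)].

Definition injectively_colourable (k : nat) : bool :=
  [exists c : {ffun T -> 'I_k}, is_injective_colouring c].

Lemma ex_injectively_colourable : exists k, injectively_colourable k.
Proof.
exists #|T|; apply/existsP; exists (finfun (@enum_rank T)).
apply/forallP=> x; apply/forallP=> y; apply/implyP=> /andP[neq_xy _].
by rewrite !ffunE (inj_eq enum_rank_inj).
Qed.

Definition injective_chromatic_number : nat := ex_minn ex_injectively_colourable.

End InjectiveColouring.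

(* [(s, i)] is the vertex with index [i] in the family [s]; the four families
   are encoded by the elements of [bool * bool]. *)
Definition dodec_vertex (r : nat) : finType := (bool * bool * 'I_r)%type.

Section GeneralisedDodecahedron.
Variable r : nat.

Definition vtx_u (i : 'I_r) : dodec_vertex r := (false, false, i).
Definition vtx_v (i : 'I_r) : dodec_vertex r := (true, false, i).
Definition vtx_u' (i : 'I_r) : dodec_vertex r := (false, true, i).
Definition vtx_v' (i : 'I_r) : dodec_vertex r := (true, true, i).

(* Each edge is listed once, in one direction; [ordS] is the successor
   modulo [r]. *)
Definition dodec_edge (x y : dodec_vertex r) : bool :=
  [exists i : 'I_r,
    (x, y) \in [:: (vtx_u i, vtx_u (ordS i)); (vtx_v i, vtx_v (ordS i));
                   (vtx_u i, vtx_u' i); (vtx_v i, vtx_v' i);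
                   (vtx_v' i, vtx_u' i); (vtx_u' i, vtx_v' (ordS i))]].

Definition dodec_adj : rel (dodec_vertex r) :=
  [rel x y | dodec_edge x y || dodec_edge y x].

Lemma dodec_adj_sym : symmetric dodec_adj.
Proof. by move=> x y; apply: orbC. Qed.

Lemma dodec_adj_irr : 1 < r -> irreflexive dodec_adj.
Proof.
move=> r_gt1 x; apply/negbTE; rewrite /dodec_adj /= orbb; apply/existsP=> -[i].
have neq_S : (i == ordS i) = false.
  rewrite -val_eqE /=; have [lt_iSr | le_riS] := ltnP i.+1 r.
    by rewrite modn_small // ltn_eqF.
  have def_r : i.+1 = r by apply/eqP; rewrite eqn_leq le_riS ltn_ord.
  rewrite def_r modnn; apply/negbTE; rewrite -lt0n -ltnS def_r //.
case: x => [[a b] j]; rewrite !inE !xpair_eqE.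
case: (j =P i) => [->|_]; rewrite ?neq_S ?andbF /=; by case: a; case: b.
Qed.

End GeneralisedDodecahedron.

(* Main.v *)
Require Import Defs.
From mathcomp Require Import all_boot.
From mathcomp Require Import zify.

(** In an injective colouring every neighbourhood is rainbow.  If [g] colours
    the cycle [C_r] so that any three consecutive colours are distinct, then
    giving [u_i], [u'_i] the colour [g i] and [v_i], [v'_i] the colour
    [g (i + 1)] is an injective colouring; such a [g] with four colours exists
    as soon as [r] is a sum of threes and fours, and with three colours when
    [3] divides [r].  Only [r = 5] needs a separate colouring.  Conversely, with
    three colours a short chase shows that [u_i] and [u_(i+1)] always get
    different colours; hence any three consecutive [u]-colours are distinct,
    the sequence of [u]-colours has period [3], and [3] divides [r]. *)

Lemma uniq3E (T : eqType) (x y z : T) :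
  uniq [:: x; y; z] = [&& x != y, x != z & y != z].
Proof. by rewrite /= !inE negb_or andbT andbA. Qed.

Section Neighbourhoods.
Variable r : nat.
Local Notation S := (@ordS r).
Local Notation P := (@ord_pred r).

Definition dodec_nbrs (z : dodec_vertex r) : seq (dodec_vertex r) :=
  match z with
  | (false, false, i) => [:: vtx_u (P i); vtx_u (S i); vtx_u' i]
  | (true, false, i) => [:: vtx_v (P i); vtx_v (S i); vtx_v' i]
  | (false, true, i) => [:: vtx_u i; vtx_v' i; vtx_v' (S i)]
  | (true, true, i) => [:: vtx_v i; vtx_u' i; vtx_u' (P i)]
  end.

Lemma dodec_adjE z x : dodec_adj z x = (x \in dodec_nbrs z).
Proof.
apply/idP/idP.
  case/orP=> /existsP[i]; rewrite !inE.
    by do 5?[case/orP]; move=> /eqP[-> ->] /=; rewrite !inE ?ordSK ?eqxx ?orbT.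
  by do 5?[case/orP]; move=> /eqP[-> ->] /=; rewrite !inE ?ordSK ?eqxx ?orbT.
have edge i j y : (j, y) \in [:: (vtx_u i, vtx_u (S i)); (vtx_v i, vtx_v (S i));
    (vtx_u i, vtx_u' i); (vtx_v i, vtx_v' i);
    (vtx_v' i, vtx_u' i); (vtx_u' i, vtx_v' (S i))] -> dodec_edge j y.
  by move=> jy; apply/existsP; exists i.
case: z => [[[] []] i] /=; rewrite !inE => /or3P[] /eqP->; apply/orP;
  (by left; apply: (edge i); rewrite !inE eqxx ?orbT) ||
  (by right; apply: (edge i); rewrite !inE eqxx ?orbT) ||
  (by right; apply: (edge (P i)); rewrite !inE ord_predK eqxx ?orbT).
Qed.

Lemma val_ordS i : nat_of_ord (S i) = if i.+1 == r then 0 else i.+1.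
Proof.
rewrite /=; case: eqP => [->|neq]; first by rewrite modnn.
by rewrite modn_small //; have := ltn_ord i; lia.
Qed.

Lemma val_iter_ordS n i : nat_of_ord (iter n S i) = (i + n) %% r.
Proof.
elim: n => [|n IHn] /=; first by rewrite addn0 modn_small.
by rewrite IHn -addn1 modnDml addn1 addnS.
Qed.

Lemma ordS_neq i : 1 < r -> i != S i.
Proof.
move=> r_gt1; rewrite -(inj_eq (@ord_inj _)) val_ordS; have := ltn_ord i.
by case: ifP; lia.
Qed.

Lemma ordS2_neq i : 2 < r -> i != S (S i).
Proof.
move=> r_gt2; rewrite -(inj_eq (@ord_inj _)) !val_ordS; have := ltn_ord i.
by do 2?case: ifP; lia.
Qed.

Lemma dodec_nbrs_uniq z : 2 < r -> uniq (dodec_nbrs z).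
Proof.
move=> r_gt2; case: z => [[s t] i]; rewrite -(ord_predK i).
have := (ordS_neq (P i) (ltnW r_gt2), ordS2_neq (P i) r_gt2).
have := ordS_neq (S (P i)) (ltnW r_gt2).
move=> /negbTE n1 [/negbTE n2 /negbTE n3].
by case: s t => [] []; rewrite /= !inE !xpair_eqE /= ?ordSK ?n1 ?n2 ?n3
  // eq_sym n2.
Qed.

(** The bound on [r] keeps the predecessor and successor of an index apart, so that a neighbour list
    has no repetition of its own. *)
Lemma injective_colouringP k (c : {ffun dodec_vertex r -> 'I_k}) : 2 < r ->
  is_injective_colouring (@dodec_adj r) c <->
  forall z, uniq (map c (dodec_nbrs z)).
Proof.
move=> r_gt2; split=> [inj z | uniq_c].
  rewrite map_inj_in_uniq ?dodec_nbrs_uniq // => x y zx zy eq_c.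
  apply/eqP/negP=> /negP neq_xy; move: inj => /forallP/(_ x)/forallP/(_ y).
  rewrite neq_xy eq_c eqxx implybF => /existsP[]; exists z.
  by rewrite !dodec_adjE zx.
apply/forallP=> x; apply/forallP=> y; apply/implyP=> /andP[neq_xy /existsP[z]].
rewrite !dodec_adjE => /andP[/(nthP z)[i lt_i def_x] /(nthP z)[j lt_j def_y]].
have := uniq_c z; rewrite -def_x -def_y -!(nth_map z (c z)) // => /nth_uniq->.
- by apply: contraNneq neq_xy => eq_ij; rewrite -def_x -def_y eq_ij.
- by rewrite size_map.
- by rewrite size_map.
Qed.

(** Three of the four neighbourhoods are centred at [S i], so that only successors occur;
    instantiating at [P i] recovers them. *)
Lemma rainbow_colouring k (c : {ffun dodec_vertex r -> 'I_k}) : 2 < r ->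
  (forall i,
    [/\ uniq [:: c (vtx_u i); c (vtx_u (S (S i))); c (vtx_u' (S i))],
        uniq [:: c (vtx_v i); c (vtx_v (S (S i))); c (vtx_v' (S i))],
        uniq [:: c (vtx_u i); c (vtx_v' i); c (vtx_v' (S i))]
      & uniq [:: c (vtx_v (S i)); c (vtx_u' (S i)); c (vtx_u' i)]]) ->
  injectively_colourable (@dodec_adj r) k.
Proof.
move=> r_gt2 rb; apply/existsP; exists c; apply/injective_colouringP => //.
case=> [[s t] i]; case: (rb i) (rb (P i)) => _ _ uniq_u' _.
rewrite !ord_predK => -[uniq_u uniq_v _ uniq_v'].
by case: s t => [] [].
Qed.

Lemma cycle_square_colouring k (g : 'I_r -> 'I_k) : 2 < r ->
  (forall i, uniq [:: g i; g (S i); g (S (S i))]) ->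
  injectively_colourable (@dodec_adj r) k.
Proof.
move=> r_gt2 uniq_g.
(* With the [v] and [v'] families shifted by one, every neighbourhood receives three consecutive
   values of [g]. *)
apply: (@rainbow_colouring _ [ffun x => g (if x.1.1 then S x.2 else x.2)]) => //.
move=> i; rewrite !ffunE !uniq3E /=; have gC a b : (g a != g b) = (g b != g a) by rewrite eq_sym.
move: (uniq_g (S i)) (uniq_g i); rewrite !uniq3E.
move=> /and3P[n1 n2 n3] /and3P[n4 n5 _].
by rewrite n1 n2 n4 n5 (gC _ (S (S i))) n3 (gC _ (S i)) n1 !(gC _ i) n4 n5.
Qed.

Lemma dodec_colourable : 2 < r -> 4 * (r %% 3) <= r ->
  injectively_colourable (@dodec_adj r) (if r %% 3 == 0 then 3 else 4).
Proof.
move=> r_gt2 le_m.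
have -> : (if r %% 3 == 0 then 3 else 4) = (2 + (r %% 3 != 0)).+1.
  by case: eqP.
(* There are [r %% 3] blocks 0123, then blocks 012; the remaining length is a multiple of 3. All
   blocks start with 012, so the junctions, including the one back to index 0, are harmless. *)
pose h i := if i < 4 * (r %% 3) then i %% 4 else (i - 4 * (r %% 3)) %% 3.
apply: (@cycle_square_colouring _ (fun i => inord (h i))) => // i.
rewrite uniq3E -!(inj_eq (@ord_inj _)).
have h_ok j : h j < (2 + (r %% 3 != 0)).+1.
  by rewrite /h; case: ifP; case: (r %% 3 =P 0); lia.
rewrite !inordK // !val_ordS /h.
have := ltn_ord i; move: (nat_of_ord i) => j lt_jr.
have r3 : r %% 3 < 3 by rewrite ltn_mod.
move def_m : (r %% 3) le_m r3 => [|[|[|//]]] le_m _ /=.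
all: by do 3?case: ifP; do 3?case: ifP; lia.
Qed.

Lemma third_colour k (a b x y : 'I_k) : k <= 3 -> a != b ->
  a != x -> b != x -> a != y -> b != y -> x = y.
Proof.
move=> le_k3 ab ax bx ay by'; apply/eqP; apply: contraTT le_k3 => xy.
rewrite -ltnNge -[X in _ < X]card_ord cardT.
apply: (@uniq_leq_size _ [:: a; b; x; y]) => [|z _]; last by rewrite mem_enum.
by rewrite /= !inE !negb_or ab ax bx ay by' xy.
Qed.

Section ThreeColours.
Variables (k : nat) (c : {ffun dodec_vertex r -> 'I_k}).
Hypotheses (r_gt2 : 2 < r) (k_le3 : k <= 3).
Hypothesis inj_c : is_injective_colouring (@dodec_adj r) c.

Let u i := c (vtx_u i).
Let v i := c (vtx_v i).
Let u' i := c (vtx_u' i).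
Let v' i := c (vtx_v' i).

(** Write indices relative to [i] and let a be the supposed common colour of u_1 and u_2. Then a is
    missing from u'_0, ..., u'_3 and from v'_1, v'_2, v'_3. This forces v_1 = a, hence v_3 = v'_3,
    whereas u'_2 and u'_3 force v_3 = a. *)
Lemma consecutive_u_neq i : u (S i) != u (S (S i)).
Proof.
have N z := (injective_colouringP _ _ r_gt2).1 inj_c z.
have third := third_colour _ _ _ _ _ k_le3.
apply/negP=> /eqP eq_u.
move: (N (vtx_u i)) (N (vtx_u (S i))) (N (vtx_u (S (S i))))
  (N (vtx_u (S (S (S i))))) (N (vtx_u' (S i))) (N (vtx_u' (S (S i))))
  (N (vtx_v (S (S i)))) (N (vtx_v' (S i))) (N (vtx_v' (S (S i))))
  (N (vtx_v' (S (S (S i))))).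
rewrite /dodec_nbrs [map]lock /= -lock !ordSK /map !uniq3E.
rewrite -![c (vtx_u _)]/(u _) -![c (vtx_v _)]/(v _).
rewrite -![c (vtx_u' _)]/(u' _) -![c (vtx_v' _)]/(v' _) -!eq_u.
move=> /and3P[_ _ u0'] /and3P[_ _ u1'] /and3P[_ u2' _] /and3P[_ u3' _].
move=> /and3P[v1' uv2' v12'] /and3P[_ uv3' v23'] /and3P[v13 v12 v32].
move=> /and3P[w11 w10 u10'] /and3P[w22 w21 u21'] /and3P[w33 w32 u32'].
have eq_v' : v' (S (S (S i))) = v' (S i).
  by apply: (third (u (S i)) (v' (S (S i)))); rewrite // eq_sym.
have eq_v : v (S (S i)) = u (S i).
  by apply: (third (u' (S i)) (u' (S (S i)))); rewrite // eq_sym.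
(* If v_1 = v'_1, the colours of u'_0 and u'_1 leave only a for v_1, but v'_1 avoids a. *)
have [v1|neq_v1] := eqVneq (v (S i)) (v' (S i)).
  suff eq_uv : u (S i) = v (S i) by rewrite eq_uv v1 eqxx in v1'.
  by apply: (third (u' (S i)) (u' i)); rewrite // eq_sym.
have eq_uv : u (S i) = v (S i).
  by apply: (third (v' (S i)) (v' (S (S i)))); rewrite // eq_sym.
have v3 : v (S (S (S i))) = v' (S (S (S i))).
  by apply: (third (u (S i)) (v' (S (S i)))); rewrite // ?eq_uv // eq_sym.
suff eq_uv3 : u (S i) = v (S (S (S i))) by rewrite eq_uv3 v3 eqxx in uv3'.
by apply: (third (u' (S (S i))) (u' (S (S (S i))))); rewrite // eq_sym.
Qed.

Lemma three_colours_dvd : 3 %| r.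
Proof.
have third := third_colour _ _ _ _ _ k_le3.
pose f n := u (iter n S (Ordinal (ltnW (ltnW r_gt2)))).
have f1 n : f n.+1 != f n.+2 by apply: consecutive_u_neq.
have f2 n : f n != f n.+2.
  have := (injective_colouringP _ _ r_gt2).1 inj_c
    (vtx_u (iter n.+1 S (Ordinal (ltnW (ltnW r_gt2))))).
  by rewrite uniq3E /= ordSK => /and3P[].
(* Both values are the colour left over by [f n.+2] and [f n.+3]. Periodicity is stated from index 1
   on, since [f1] starts there. *)
have f3 n : f n.+4 = f n.+1.
  by apply/esym/(third (f n.+2) (f n.+3)); rewrite // eq_sym.
have f_mod q m : f (3 * q + m).+1 = f m.+1.
  by elim: q => // q IHq; rewrite mulnS -addnA f3.
have f_r : f r.+1 = f 1.
  by congr u; apply: ord_inj; rewrite !val_iter_ordS addnS -addSn modnDr.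
(* Going once round gives [f (r %% 3).+1 = f 1]; remainders 1 and 2 would identify [f 1] with [f 2]
   or [f 3]. *)
move: f_r (f1 0) (f2 1); rewrite {1}(divn_eq r 3) mulnC f_mod /dvdn.
have := ltn_pmod r (isT : 0 < 3).
by case: (r %% 3) => [|[|[|//]]] // _ ->; rewrite eqxx.
Qed.
End ThreeColours.

End Neighbourhoods.

(** Since 5 is not a sum of threes and fours, an explicit table is checked by computation. *)
Lemma dodec5_colourable : injectively_colourable (@dodec_adj 5) 4.
Proof.
pose table (s : bool * bool) := match s with
  | (false, false) => [:: 0; 1; 2; 2; 3]
  | (false, true) => [:: 0; 1; 0; 1; 3]
  | (true, true) => [:: 1; 2; 0; 1; 0]
  | (true, false) => [:: 1; 2; 3; 3; 0]
  end.
pose c := [ffun x : dodec_vertex 5 =>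
  (* Reduction modulo 4 leaves the entries unchanged and only supplies the bound. *)
  Ordinal (ltn_pmod (nth 0 (table x.1) x.2) (isT : 0 < 4))].
apply: (@rainbow_colouring _ _ c) => // i; rewrite !ffunE.
by case: i => [[|[|[|[|[|]]]]] lt_i].
Qed.

Theorem theorem19 (r : nat) (r_ge5 : 5 <= r) :
  injective_chromatic_number (@dodec_adj r) = 4 <-> r <> 0 %[mod 3].
Proof.
have r_gt2 : 2 < r by apply: leq_trans r_ge5.
rewrite /injective_chromatic_number mod0n; case: ex_minnP => n col_n min_n.
split=> [n4 r3 | r3].
  have := min_n _ (dodec_colourable r r_gt2 _).
  by rewrite r3 muln0 n4 => /(_ isT).
apply/eqP; rewrite eqn_leq; apply/andP; split.
  apply: min_n; have [->|r_neq5] := eqVneq r 5; first exact: dodec5_colourable.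
  move/eqP/negbTE: (r3) => r3F.
  (* Among all [r] at least 5, the inequality [4 * (r %% 3) <= r] fails only at 5. *)
  by have := dodec_colourable r r_gt2; rewrite r3F; apply; lia.
rewrite ltnNge; apply/negP=> n_le3; case/existsP: col_n => c inj_c.
by case: r3; apply/eqP; apply: three_colours_dvd inj_c.
Qed.
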